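(* Let $(X,d)$ be a nonempty complete metric space and let $A:X\times X\to[0,\infty)$ be a function for which there exist real constants $\delta>0$ and $r>0$ such that $$A(x,y)\ \ge\ \delta\, d(x,y)^r\qquad\text{for all } x,y\in X.$$ Let $T:X\to X$ be a mapping and let $\lambda\in(0,1)$ be such that $$A(Tx,Ty)\ \le\ \lambda\, A(x,y)\qquad\text{for all } x,y\in X.$$ Assume furthermore that for every $u\in X$ and every sequence $(x_n)$ in $X$, $$x_n\to u \text{ in } (X,d)\quad\Longrightarrow\quad A(x_n,u)\to 0.$$ Then $T$ admits a unique fixed point, i.e. there exists exactly one $u\in X$ with $Tu=u$.
   Context: The function $A$ is an arbitrary nonnegative real-valued function on $X\times X$; it is not assumed to be symmetric or to satisfy the triangle inequality or any other metric axiom. Convergence $x_n\to u$ is with respect to the metric $d$, and $A(x_n,u)\to 0$ is convergence of real numbers. *)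

(* Defs.v *)
From HB Require Import structures.
From mathcomp Require Import all_boot all_order all_algebra.
From mathcomp Require Import all_classical all_reals all_analysis.

Set Implicit Arguments.
Unset Strict Implicit.
Unset Printing Implicit Defensive.

(* [Complete] extends [isPointed], so a [completeMetricType R] is nonempty. *)
#[short(type="completeMetricType")]
HB.structure Definition CompleteMetric (R : numDomainType) :=
  { T of Complete T & Metric R T }.

(* Main.v *)
Require Import Defs.
From HB Require Import structures.
From mathcomp Require Import all_boot all_order all_algebra.
From mathcomp Require Import all_classical all_reals all_analysis.
From mathcomp Require Import ring lra.

(** Banach's iteration argument works for [A] even without symmetry or a
    triangle inequality, because the lower bound [delta * d^r <= A] transfers
    what is needed to the metric [d].

    Along an orbit [x_n = T^n x_0], contraction gives
    [A x_n x_(n+1) <= lambda^n * A x_0 x_1].  Taking [r]-th roots, the distances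
    of consecutive terms are at most [C * q^n] with [q = lambda^(1/r) < 1], so
    the triangle inequality of [d] makes the orbit Cauchy
    ([cvg_geometric_steps]).  The limit [u] is fixed: the last assumption on [A]
    gives [A x_n u --> 0], contraction gives [A x_(n+1) (T u) --> 0], the lower
    bound turns this into [x_(n+1) --> T u] ([cvg_of_dominating]), and limits in
    a metric space are unique.  Two fixed points [u] and [v] satisfy
    [A u v <= lambda * A u v], hence [A u v <= 0] and [d u v = 0]. *)

Set Implicit Arguments.
Unset Strict Implicit.
Unset Printing Implicit Defensive.

Import Order.TTheory GRing.Theory Num.Theory.
Import numFieldNormedType.Exports.
Local Open Scope classical_set_scope.
Local Open Scope ring_scope.

Lemma le_powRV (R : realType) (r x y : R) :
  0 < r -> 0 <= x -> x `^ r <= y -> x <= y `^ r^-1.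
Proof.
move=> r0 x0 xy.
have y0 : 0 <= y by apply: le_trans xy; exact: powR_ge0.
have -> : x = (x `^ r) `^ r^-1 by rewrite -powRrM mulfV ?gt_eqF// powRr1.
by apply: ge0_ler_powR; rewrite ?nnegrE ?powR_ge0// invr_ge0 ltW.
Qed.

(** The invariant carries the subtracted term [C / (1 - q) * q^(n + k)], the
    tail of the geometric series, so that the induction on [k] closes; dropping
    it leaves a bound uniform in [k]. *)
Lemma mdist_geometric_steps (R : realType) (X : metricType R) (x_ : nat -> X)
    (C q : R) : q < 1 ->
  (forall n, mdist (x_ n) (x_ n.+1) <= C * q ^+ n) ->
  forall n k, mdist (x_ n) (x_ (n + k)%N) <=
    C / (1 - q) * q ^+ n - C / (1 - q) * q ^+ (n + k).
Proof.
move=> q1 step n; elim=> [|k IH]; first by rewrite addn0 mdistxx subrr.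
rewrite addnS; apply: le_trans (metric_triangle _ (x_ (n + k)%N) _) _.
apply: le_trans (lerD IH (step _)) _.
rewrite exprS le_eqVlt; apply/orP; left; apply/eqP; field.
by rewrite subr_eq0 gt_eqF.
Qed.

Lemma cvg_geometric_steps (R : realType) (X : completeMetricType R)
    (x_ : nat -> X) (C q : R) : 0 <= q -> q < 1 ->
  (forall n, mdist (x_ n) (x_ n.+1) <= C * q ^+ n) ->
  cvg (x_ n @[n --> \oo]).
Proof.
move=> q0 q1 step; apply: cauchy_cvg; apply/cauchy_exP => e e0.
have C0 : 0 <= C.
  by have := step 0; rewrite expr0 mulr1; apply: le_trans; exact: mdist_ge0.
have D0 : 0 <= C / (1 - q) by rewrite divr_ge0// subr_ge0 ltW.
have tail0 : C / (1 - q) * q ^+ n @[n --> \oo] --> 0.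
  by apply: cvg_geometric; rewrite ger0_norm.
have [N _ tailN] := cvgr_lt _ tail0 _ e0.
exists (x_ N); exists N => //= n Nn.
rewrite ballEmdist/= -(subnKC Nn).
apply: le_lt_trans (mdist_geometric_steps q1 step _ _) _.
apply: le_lt_trans (tailN N (leqnn N)).
by rewrite gerBl mulr_ge0// exprn_ge0.
Qed.

(** A value of [A] below [delta * e^r] forces a distance below [e], so smallness
    of [A] is at least as strong as closeness for [d]. *)
Lemma cvg_of_dominating (R : realType) (X : metricType R) (A : X -> X -> R)
    (delta r : R) (x_ : nat -> X) (u : X) : 0 < delta -> 0 < r ->
  (forall x y, delta * mdist x y `^ r <= A x y) ->
  A (x_ n) u @[n --> \oo] --> 0 -> x_ n @[n --> \oo] --> u.
Proof.
move=> d0 r0 dA Au; apply/metricType_numDomainType.cvgrPdist_lt => e e0.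
have de0 : 0 < delta * e `^ r by rewrite mulr_gt0// powR_gt0.
have [N _ AN] := cvgr_lt _ Au _ de0; exists N => // n Nn /=.
rewrite ltNge; apply/negP => ed.
have : delta * e `^ r <= A (x_ n) u.
  apply: le_trans (dA _ _); rewrite ler_pM2l// metric_sym.
  by apply: ge0_ler_powR; rewrite ?nnegrE ?mdist_ge0// ltW.
by rewrite leNgt AN.
Qed.

Lemma iter_contraction (R : realType) (X : Type) (A : X -> X -> R) (T : X -> X)
    (lambda : R) : 0 <= lambda ->
  (forall x y, A (T x) (T y) <= lambda * A x y) ->
  forall x y n, A (iter n T x) (iter n T y) <= lambda ^+ n * A x y.
Proof.
move=> l0 TA x y; elim=> [|n IH]; first by rewrite mul1r.
by rewrite !iterS exprS -mulrA; apply: le_trans (TA _ _) _; rewrite ler_wpM2l.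
Qed.

Theorem theorem2p2 (R : realType) (X : completeMetricType R)
    (A : X -> X -> R) (T : X -> X) (lambda : R) :
  (forall x y : X, 0 <= A x y) ->
  (exists delta r : R, [/\ 0 < delta, 0 < r &
     forall x y : X, delta * mdist x y `^ r <= A x y]) ->
  0 < lambda -> lambda < 1 ->
  (forall x y : X, A (T x) (T y) <= lambda * A x y) ->
  (forall (u : X) (x_ : nat -> X),
     x_ n @[n --> \oo] --> u -> A (x_ n) u @[n --> \oo] --> (0 : R)) ->
  exists! u : X, T u = u.
Proof.
move=> A0 [delta [r [d0 r0 dA]]] l0 l1 TA Acvg.
have rV0 : 0 < r^-1 by rewrite invr_gt0.
pose x_ n := iter n T (point : X).
pose q := lambda `^ r^-1.
have q1 : q < 1.
  have -> : 1 = 1 `^ r^-1 :> R by rewrite powR1.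
  by apply: gt0_ltr_powR; rewrite ?nnegrE// ltW.
pose C := (A (x_ 0) (x_ 1) / delta) `^ r^-1.
have step n : mdist (x_ n) (x_ n.+1) <= C * q ^+ n.
  have -> : C * q ^+ n = (lambda ^+ n * A (x_ 0) (x_ 1) / delta) `^ r^-1.
    rewrite -mulrA [RHS]powRM; last 2 first.
    - exact/exprn_ge0/ltW.
    - by rewrite divr_ge0// ltW.
    rewrite mulrC; congr (_ * _).
    by rewrite -!powR_mulrn ?powR_ge0 ?(ltW l0)// powRAC.
  apply: le_powRV => //; first exact: mdist_ge0.
  rewrite ler_pdivlMr// mulrC; apply: le_trans (dA _ _) _.
  by rewrite /x_ iterSr; apply: iter_contraction => //; exact: ltW.
have /cvg_ex[u xu] : cvg (x_ n @[n --> \oo]).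
  by apply: cvg_geometric_steps step => //; exact: powR_ge0.
have ATu : A (x_ n.+1) (T u) @[n --> \oo] --> 0.
  apply: (@squeeze_cvgr _ _ _ _ (fun=> 0) (fun n => lambda * A (x_ n) u)).
  - by apply: nearW => n; rewrite A0 TA.
  - exact: cvg_cst.
  - by rewrite -[X in _ --> X](mulr0 lambda); apply: cvgM; [exact: cvg_cst|exact: Acvg].
have xTu : x_ n.+1 @[n --> \oo] --> T u := cvg_of_dominating d0 r0 dA ATu.
have Tu : T u = u.
  apply: (cvg_unique (@metric_hausdorff _ X) xTu).
  by have := xu; rewrite -(cvg_shiftS x_).
exists u; split=> // v Tv; apply: mdist_positivity.
have Auv : A u v <= 0.
  by have := TA u v; rewrite Tu Tv; have := A0 u v; nra.
have : mdist u v `^ r <= 0.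
  by rewrite -(pmulr_rle0 _ d0); exact: le_trans (dA _ _) Auv.
by rewrite le_eqVlt ltNge powR_ge0 orbF => /eqP/powR_eq0_eq0.
Qed.
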